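(* Let $k$ be a field and let $A$ be a symmetric split $k$-algebra. We have $$\sum_S \dim_k(\mathrm{Ext}^1_A(S,S)) \leq \dim_k(\mathrm{soc}_{Z(A)}(HH^1(A))),$$ where in the sum $S$ runs over a set of representatives of the isomorphism classes of simple $A$-modules. In particular, if $A$ is a symmetric split local $k$-algebra, then $$\dim_k(J(A)/J(A)^2) \leq \dim_k(\mathrm{soc}_{Z(A)}(HH^1(A))).$$
   Context: A $k$-algebra $A$ is symmetric if $A$ is isomorphic to its $k$-dual $A^\vee$ as an $A$-$A$-bimodule (this implies that $A$ is finite-dimensional); $A$ is split if $A/J(A)$ is a direct product of matrix algebras over $k$, where $J(A)$ is the Jacobson radical. The first Hochschild cohomology is $HH^1(A)=\mathrm{Der}(A)/\mathrm{IDer}(A)$ (derivations modulo inner derivations), a module over the centre $Z(A)$ via $(z\cdot f)(a)=zf(a)$. For a $Z(A)$-module $H$, $\mathrm{soc}_{Z(A)}(H)$ denotes its socle as a $Z(A)$-module. *)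

(* Defs.v *)
From HB Require Import structures.
From mathcomp Require Import all_boot all_order all_algebra all_field.
From mathcomp Require Import generic_quotient ring_quotient boolp.

Set Implicit Arguments.
Unset Strict Implicit.
Unset Printing Implicit Defensive.

Import GRing.Theory.
Local Open Scope ring_scope.
Local Open Scope quotient_scope.

(* The subspace spanned by an arbitrary Prop-valued predicate. When the       *)
(* predicate is closed under linear combinations this is the predicate itself *)
(* seen as a {vspace V}, by mem_vspan.                                        *)
Section Vspan.
Variables (k : fieldType) (V : vectType k).
Implicit Types (P : V -> Prop) (U W : {vspace V}).

Definition lin_closed P : Prop :=
  P 0 /\ forall (a : k) u v, P u -> P v -> P (a *: u + v).

Lemma vspan_subproof P : exists U : {vspace V},
  (forall v, P v -> v \in U) /\
  (forall W : {vspace V}, (forall v, P v -> v \in W) -> (U <= W)%VS).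
Proof.
pose Q n := `[< exists U : {vspace V}, (forall v, P v -> v \in U) /\ \dim U = n >].
have exQ : exists n, Q n.
  by exists (\dim {:V}); apply/asboolP; exists fullv; split=> // v _; apply: memvf.
case: (ex_minnP exQ) => m /asboolP[U [PU dU]] minm.
exists U; split=> // W PW.
have : (m <= \dim (U :&: W))%N.
  apply: minm; apply/asboolP; exists (U :&: W)%VS; split=> // v Pv.
  by rewrite memv_cap PU ?PW.
rewrite -dU => dle; apply/capv_idPl/eqP.
by rewrite eqEdim capvSl.
Qed.

Definition vspan P : {vspace V} := projT1 (cid (vspan_subproof P)).

Lemma vspan_sub P v : P v -> v \in vspan P.
Proof. by rewrite /vspan; case: cid => U [] /= /(_ v). Qed.

Lemma vspan_min P W : (forall v, P v -> v \in W) -> (vspan P <= W)%VS.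
Proof. by rewrite /vspan; case: cid => U [] /= _; apply. Qed.

Lemma mem_vspan P v : lin_closed P -> v \in vspan P <-> P v.
Proof.
move=> [P0 PD]; split; last exact: vspan_sub.
pose Q n := `[< exists U : {vspace V}, (forall v, v \in U -> P v) /\ \dim U = n >].
have exQ : exists n, Q n.
  exists 0%N; apply/asboolP; exists 0%VS; rewrite dimv0.
  by split=> // u; rewrite memv0 => /eqP->.
have bQ n : Q n -> (n <= \dim {:V})%N.
  by move=> /asboolP[U [_ <-]]; apply/dimvS/subvf.
case: (ex_maxnP exQ bQ) => m /asboolP[U [UP dU]] maxm vP.
apply: (UP); apply: (subvP (vspan_min _) v vP) => u Pu.
have : (\dim (<[u]> + U)%VS <= m)%N.
  apply: maxm; apply/asboolP; exists (<[u]> + U)%VS; split=> // x.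
  by move=> /memv_addP[_ /vlineP[a ->] [w /UP Pw ->]]; apply: PD.
rewrite -dU => dle.
have /eqP -> : (U == <[u]> + U)%VS by rewrite eqEdim addvSr dle.
by apply: (subvP (addvSl _ _)); apply: memv_line.
Qed.

End Vspan.

Section QuotV.
Variables (k : fieldType) (V : vectType k) (U : {vspace V}).

Definition quotv := Quotient.quot (pred_of_vspace U : zmodClosed V).

HB.instance Definition _ := Choice.on quotv.
HB.instance Definition _ := GRing.Zmodule.on quotv.
HB.instance Definition _ := EqQuotient.on quotv.

Definition quotv_pi (v : V) : quotv := \pi_quotv v.

Lemma quotv_piE u v : quotv_pi u = quotv_pi v <-> u - v \in U.
Proof.
rewrite /quotv_pi (_ : (u - v \in U) = (u == v %[mod quotv])).
  by split=> [->|/eqP].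
exact: (Quotient.idealrBE (pred_of_vspace U : zmodClosed V)).
Qed.

Lemma quotv_piK (x : quotv) : quotv_pi (repr x) = x.
Proof. exact: reprK. Qed.

Lemma quotv_piD u v : quotv_pi (u + v) = quotv_pi u + quotv_pi v.
Proof. exact: (Quotient.pi_add (pred_of_vspace U : zmodClosed V)). Qed.

Definition quotv_scale (a : k) (x : quotv) : quotv := quotv_pi (a *: repr x).

Lemma quotv_piZ a v : quotv_pi (a *: v) = quotv_scale a (quotv_pi v).
Proof.
apply/quotv_piE; rewrite -scalerBr memvZ //.
by apply/quotv_piE; rewrite quotv_piK.
Qed.

Lemma quotv_ind (P : quotv -> Prop) : (forall v, P (quotv_pi v)) -> forall x, P x.
Proof. by move=> H x; rewrite -(quotv_piK x). Qed.

Fact quotv_scaleA a b x : quotv_scale a (quotv_scale b x) = quotv_scale (a * b) x.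
Proof. by elim/quotv_ind: x => v; rewrite -!quotv_piZ scalerA. Qed.
Fact quotv_scale1 : left_id 1 quotv_scale.
Proof. by elim/quotv_ind=> v; rewrite -quotv_piZ scale1r. Qed.
Fact quotv_scaleDr : right_distributive quotv_scale +%R.
Proof.
move=> a; elim/quotv_ind=> u; elim/quotv_ind=> v.
by rewrite -quotv_piD -!quotv_piZ -quotv_piD scalerDr.
Qed.
Fact quotv_scaleDl x : {morph quotv_scale^~ x : a b / a + b}.
Proof.
by move=> a b; elim/quotv_ind: x => v; rewrite -!quotv_piZ -quotv_piD scalerDl.
Qed.

HB.instance Definition _ := GRing.Zmodule_isLmodule.Build k quotv
  quotv_scaleA quotv_scale1 quotv_scaleDr quotv_scaleDl.

Fact quotv_pi_is_linear : linear quotv_pi.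
Proof. by move=> a u v; rewrite quotv_piD quotv_piZ. Qed.
HB.instance Definition _ := GRing.isSemilinear.Build k V quotv _ quotv_pi
  (GRing.semilinear_linear quotv_pi_is_linear).

Import VectorInternalTheory.

Let cpl (v : V) : subvs_of U^C := vsproj U^C (v - projv U v).

Fact quotv_vect_iso : Vector.axiom (\dim U^C) quotv.
Proof.
have cplP v : vsval (cpl v) = v - projv U v by rewrite vsprojK ?memv_projC.
have cpl_pi v : quotv_pi (vsval (cpl v)) = quotv_pi v.
  by apply/quotv_piE; rewrite cplP addrAC subrr sub0r rpredN memv_proj.
have cplE v : cpl (repr (quotv_pi v)) = cpl v.
  have /quotv_piE Uw : quotv_pi (repr (quotv_pi v)) = quotv_pi v.
    exact: quotv_piK.
  apply: val_inj; rewrite /= !cplP -[X in X - _](subrK v).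
  rewrite -[X in projv U X](subrK v) linearD /= (projv_id Uw).
  by rewrite opprD addrACA subrr add0r.
exists (fun x => v2r (cpl (repr x))).
  move=> a; elim/quotv_ind=> u; elim/quotv_ind=> v.
  rewrite -quotv_pi_is_linear !cplE.
  have -> : cpl (a *: u + v) = a *: cpl u + cpl v.
    apply: val_inj.
    by rewrite /= !cplP linearP scalerBr opprD addrACA.
  by rewrite linearD linearZ.
exists (fun r => quotv_pi (vsval (r2v r))) => [|r].
  by elim/quotv_ind=> v; rewrite v2rK cplE cpl_pi.
rewrite cplE -[RHS]r2vK; congr v2r; apply: val_inj; rewrite /= cplP.
suff -> : projv U (vsval (r2v r)) = 0 by rewrite subr0.
by apply/eqP; rewrite -memv_ker lker_proj subvsP.
Qed.

HB.instance Definition _ := Lmodule_hasFinDim.Build k quotv quotv_vect_iso.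

Lemma dim_quotv : \dim {:quotv} = (\dim {:V} - \dim U)%N.
Proof. by rewrite dimvf -dimv_compl. Qed.

End QuotV.
Arguments quotv {k V} U.
Arguments quotv_pi {k V} U v.

(* U / (U :&: W), which is U / W in the intended case W <= U. *)
Definition subquot (k : fieldType) (V : vectType k) (U W : {vspace V}) :=
  quotv (linfun (vsval : subvs_of U -> V) @^-1: W)%VS.

Lemma dim_subquot (k : fieldType) (V : vectType k) (U W : {vspace V}) :
  (W <= U)%VS -> \dim {:subquot U W} = (\dim U - \dim W)%N.
Proof.
move=> sWU; rewrite /subquot dim_quotv; congr (_ - _)%N; first by rewrite dimvf.
set f := linfun _.
have fE x : f x = vsval x by rewrite lfunE.
have kerf : lker f == 0%VS.
  by apply/lker0P => x y; rewrite !fE; apply: val_inj.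
rewrite -(limg_dim_eq (f := f)) ?(eqP kerf) ?capv0 //.
rewrite lpreimK //; apply/subvP=> w Ww.
have -> : w = f (vsproj U w) by rewrite fE vsprojK // (subvP sWU).
exact/memv_img/memvf.
Qed.

(* Left A-modules that are finite-dimensional over k: as A is finite-         *)
(* dimensional, every simple A-module is of this kind.                        *)
Record amod (k : fieldType) (A : falgType k) := AMod {
  amod_sort :> vectType k;
  act : A -> amod_sort -> amod_sort;
  act_linearl : forall x, linear (act^~ x);
  act_linearr : forall a, linear (act a);
  act1 : forall x, act 1 x = x;
  actM : forall a b x, act (a * b) x = act a (act b x)
}.
Arguments act {k A M} a x : rename.

Section Modules.
Variables (k : fieldType) (A : falgType k).
Implicit Types (M N T S : amod A).

Definition is_homA M N (f : 'Hom(M, N)) : Prop :=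
  forall a x, f (act a x) = act a (f x).

Definition isoA M N : Prop :=
  exists f : 'Hom(M, N), is_homA f /\ bijective f.

(* A submodule is automatically a k-subspace. *)
Definition submod M (U : {vspace M}) : Prop :=
  forall a x, x \in U -> act a x \in U.

Definition simple_submod M (U : {vspace M}) : Prop :=
  [/\ submod U, U != 0%VS &
      forall W : {vspace M}, submod W -> (W <= U)%VS -> W = 0%VS \/ W = U].

Definition max_submod M (U : {vspace M}) : Prop :=
  [/\ submod U, U != fullv &
      forall W : {vspace M}, submod W -> (U <= W)%VS -> W = U \/ W = fullv].

Definition simpleA M : Prop := simple_submod (fullv : {vspace M}).

Definition socle M : {vspace M} :=
  vspan (fun x : M => exists2 U : {vspace M}, simple_submod U & x \in U).

Section SubModule.
Variables (M : amod A) (U : {vspace M}) (sU : submod U).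

Definition sub_act (a : A) (x : subvs_of U) : subvs_of U :=
  Subvs (sU a (subvsP x)).

Fact sub_act_linearl x : linear (sub_act^~ x).
Proof. by move=> c a b; apply: val_inj; rewrite /= act_linearl. Qed.
Fact sub_act_linearr a : linear (sub_act a).
Proof. by move=> c x y; apply: val_inj; rewrite /= act_linearr. Qed.
Fact sub_act1 x : sub_act 1 x = x.
Proof. by apply: val_inj; rewrite /= act1. Qed.
Fact sub_actM a b x : sub_act (a * b) x = sub_act a (sub_act b x).
Proof. by apply: val_inj; rewrite /= actM. Qed.

Definition sub_amod : amod A :=
  AMod sub_act_linearl sub_act_linearr sub_act1 sub_actM.
End SubModule.

Section FreeModule.
Variable n : nat.

Definition free_act (a : A) (x : {ffun 'I_n -> A}) : {ffun 'I_n -> A} :=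
  [ffun i => a * x i].

Fact free_act_linearl x : linear (free_act^~ x).
Proof. by move=> c a b; apply/ffunP=> i; rewrite !ffunE mulrDl scalerAl. Qed.
Fact free_act_linearr a : linear (free_act a).
Proof. by move=> c x y; apply/ffunP=> i; rewrite !ffunE mulrDr scalerAr. Qed.
Fact free_act1 x : free_act 1 x = x.
Proof. by apply/ffunP=> i; rewrite !ffunE mul1r. Qed.
Fact free_actM a b x : free_act (a * b) x = free_act a (free_act b x).
Proof. by apply/ffunP=> i; rewrite !ffunE mulrA. Qed.

Definition free_amod : amod A :=
  AMod free_act_linearl free_act_linearr free_act1 free_actM.
End FreeModule.

(* The free cover A^d -> M sending the standard basis to a k-basis of M, its  *)
(* kernel Omega M, and the composite P (Omega M) -> Omega M -> P M, where P   *)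
(* stands for free_cover. Iterating gives a free resolution                   *)
(*   ... -> P (Omega (Omega M)) -> P (Omega M) -> P M -> M -> 0               *)
(* (exactness: limg_cover, limg_res_diff, lker_res_diff).                     *)
Definition free_cover M : amod A := free_amod (\dim {:M}).

Definition cover_fun M (x : free_cover M) : M :=
  \sum_i act ((x : {ffun _ -> A}) i) (vbasis {:M})`_i.

Fact cover_fun_is_linear M : linear (@cover_fun M).
Proof.
move=> c x y; rewrite /cover_fun scaler_sumr -big_split /=.
by apply: eq_bigr => i _; rewrite !ffunE act_linearl.
Qed.
HB.instance Definition _ M :=
  GRing.isSemilinear.Build k (free_cover M) M _ (@cover_fun M)
  (GRing.semilinear_linear (@cover_fun_is_linear M)).

Definition cover M : 'Hom(free_cover M, M) := linfun (@cover_fun M).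

Lemma act0r M a : act a (0 : M) = 0.
Proof. by have := act_linearr a (-1) (0 : M) 0; rewrite scaler0 addr0 scaleN1r addNr. Qed.

Lemma act_sumr M a (I : finType) (F : I -> M) :
  act a (\sum_i F i) = \sum_i act a (F i).
Proof.
apply: (big_morph (act a) _ (act0r M a)) => x y.
by have := act_linearr a 1 x y; rewrite !scale1r.
Qed.

Lemma cover_homA M : is_homA (cover M).
Proof.
move=> a x; rewrite !lfunE /= /cover_fun act_sumr.
by apply: eq_bigr => i _; rewrite ffunE actM.
Qed.

Lemma limg_cover M : limg (cover M) = fullv.
Proof.
apply/eqP; rewrite eqEsubv subvf /=; apply/subvP=> x _.
pose y : free_cover M := [ffun i => coord (vbasis {:M}) i x *: 1].
have -> : x = cover M y; last exact/memv_img/memvf.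
rewrite lfunE /= /cover_fun {1}(coord_vbasis (memvf x)).
apply: eq_bigr => i _; rewrite ffunE.
have act0l z : act 0 z = 0 :> M.
  by have := act_linearl z (-1) 0 0; rewrite scaler0 addr0 scaleN1r addNr.
by have := act_linearl (vbasis {:M})`_i (coord (vbasis {:M}) i x) 1 0;
   rewrite act0l !addr0 act1 => ->.
Qed.

Fact ker_submod M N (f : 'Hom(M, N)) : is_homA f -> submod (lker f).
Proof. by move=> hf a x; rewrite !memv_ker hf => /eqP->; rewrite act0r. Qed.

Definition Omega M : amod A := sub_amod (ker_submod (@cover_homA M)).

Definition res_diff M : 'Hom(free_cover (Omega M), free_cover M) :=
  (linfun (vsval : subvs_of (lker (cover M)) -> free_cover M)
     \o cover (Omega M))%VF.

Lemma limg_res_diff M : limg (res_diff M) = lker (cover M).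
Proof.
rewrite /res_diff limg_comp limg_cover; apply/vspaceP => x; apply/memv_imgP/idP.
  by case=> y _ ->; rewrite lfunE subvsP.
by move=> xK; exists (Subvs xK); rewrite ?memvf ?lfunE.
Qed.

Lemma lker_res_diff M : lker (res_diff M) = limg (res_diff (Omega M)).
Proof.
rewrite limg_res_diff; apply/vspaceP => x; rewrite !memv_ker /res_diff comp_lfunE lfunE.
by apply/eqP/eqP => [e | -> //]; apply: val_inj.
Qed.

Lemma res_diffK M : (res_diff M \o res_diff (Omega M))%VF = 0.
Proof.
apply/lfunP => x.
have : res_diff (Omega M) x \in lker (res_diff M).
  by rewrite lker_res_diff; apply: memv_img (memvf x).
rewrite memv_ker => /eqP e.
by rewrite [RHS]zero_lfunE -e; apply: comp_lfunE.
Qed.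

(* Ext^1_A(M, T): the first cohomology of                                     *)
(*   Hom_A(P M, T) -> Hom_A(P (Omega M), T) -> Hom_A(P (Omega (Omega M)), T). *)
Definition Ext1_cocycles M T : {vspace 'Hom(free_cover (Omega M), T)} :=
  vspan (fun f => is_homA f /\ (f \o res_diff (Omega M))%VF = 0).

Definition Ext1_coboundaries M T : {vspace 'Hom(free_cover (Omega M), T)} :=
  vspan (fun f => exists2 g : 'Hom(free_cover M, T),
                    is_homA g & f = (g \o res_diff M)%VF).

Lemma homA_closed M N : lin_closed (@is_homA M N).
Proof.
split=> [a x|c f g hf hg a x]; first by rewrite !lfunE /= act0r.
by rewrite !(add_lfunE, scale_lfunE) hf hg act_linearr.
Qed.

Lemma mem_Ext1_cocycles M T f :
  f \in Ext1_cocycles M T <-> is_homA f /\ (f \o res_diff (Omega M))%VF = 0.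
Proof.
have [h0 hD] := homA_closed (free_cover (Omega M)) T.
apply: mem_vspan; split; first by split; rewrite ?comp_lfun0l.
move=> c f1 f2 [h1 e1] [h2 e2]; split; first exact: hD.
by rewrite comp_lfunDl -comp_lfunZl e1 e2 scaler0 addr0.
Qed.

Lemma mem_Ext1_coboundaries M T f :
  f \in Ext1_coboundaries M T <->
  exists2 g : 'Hom(free_cover M, T), is_homA g & f = (g \o res_diff M)%VF.
Proof.
have [h0 hD] := homA_closed (free_cover M) T.
apply: mem_vspan; split; first by exists 0; rewrite ?comp_lfun0l.
move=> c _ _ [g1 h1 ->] [g2 h2 ->]; exists (c *: g1 + g2); first exact: hD.
by rewrite comp_lfunDl -comp_lfunZl.
Qed.

Lemma res_diff_homA M : is_homA (res_diff M).
Proof. by move=> a x; rewrite !comp_lfunE cover_homA !lfunE. Qed.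

Lemma Ext1_coboundaries_sub M T : (Ext1_coboundaries M T <= Ext1_cocycles M T)%VS.
Proof.
apply/subvP=> _ /mem_Ext1_coboundaries[g hg ->]; apply/mem_Ext1_cocycles.
split=> [a x|]; first by rewrite [LHS]comp_lfunE res_diff_homA hg [in RHS]comp_lfunE.
by rewrite -comp_lfunA res_diffK comp_lfun0r.
Qed.

Definition Ext1 M T := subquot (Ext1_cocycles M T) (Ext1_coboundaries M T).

Definition simple_representatives (I : finType) (S : I -> amod A) : Prop :=
  [/\ forall i, simpleA (S i),
      forall i j, isoA (S i) (S j) -> i = j &
      forall M, simpleA M -> exists i, isoA M (S i)].

End Modules.

Section Algebra.
Variables (k : fieldType) (A : falgType k).

Fact reg_act_linearl (x : A) : linear (fun a : A => a * x).
Proof. by move=> c a b; rewrite mulrDl scalerAl. Qed.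
Fact reg_act_linearr (a : A) : linear (fun x : A => a * x).
Proof. by move=> c x y; rewrite mulrDr scalerAr. Qed.

Definition regular_amod : amod A :=
  AMod reg_act_linearl reg_act_linearr (@mul1r A) (fun a b x => esym (mulrA a b x)).

Definition max_left_ideal (U : {vspace A}) : Prop :=
  max_submod (U : {vspace regular_amod}).

(* The Jacobson radical: the intersection of the maximal left ideals. *)
Definition Jrad : {vspace A} :=
  vspan (fun x : A => forall U, max_left_ideal U -> x \in U).

Lemma mem_Jrad x : x \in Jrad <-> forall U, max_left_ideal U -> x \in U.
Proof.
apply: mem_vspan; split=> [U _|c u v hu hv U mU]; first exact: mem0v.
by rewrite rpredD ?rpredZ ?hu ?hv.
Qed.

(* The bimodule action on the dual: (a . f . b)(y) = f (b y a). *)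
Definition dual_act (a : A) (f : 'Hom(A, k^o)) (b : A) : 'Hom(A, k^o) :=
  (f \o (amull b \o amulr a))%VF.

Definition symmetricA : Prop :=
  exists phi : 'Hom(A, 'Hom(A, k^o)),
    bijective phi /\ forall a x b, phi (a * x * b) = dual_act a (phi x) b.

(* psi is an isomorphism of algebras from A / J(A) to a product of matrix     *)
(* algebras; the multiplication of A / J(A) is the one induced from A.        *)
Definition splitA : Prop :=
  exists (r : nat) (n : 'I_r -> nat)
         (psi : quotv Jrad -> {dffun forall i : 'I_r, 'M[k]_((n i).+1)}),
  [/\ bijective psi,
      forall (c : k) x y i, psi (c *: x + y) i = c *: psi x i + psi y i,
      forall i, psi (quotv_pi Jrad 1) i = 1 &
      forall a b i, psi (quotv_pi Jrad (a * b)) i =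
                    psi (quotv_pi Jrad a) i * psi (quotv_pi Jrad b) i].

Definition localA : Prop := exists! U : {vspace A}, max_left_ideal U.

Definition is_der (f : 'End(A)) : Prop :=
  forall a b, f (a * b) = f a * b + a * f b.

Definition Der : {vspace 'End(A)} := vspan is_der.

Definition IDer : {vspace 'End(A)} :=
  vspan (fun f : 'End(A) => exists c, forall a, f a = c * a - a * c).

Definition HH1 := subquot Der IDer.

Lemma mem_Der f : f \in Der <-> is_der f.
Proof.
apply: mem_vspan; split=> [a b|c f1 f2 d1 d2 a b].
  by rewrite !lfunE /= mul0r mulr0 addr0.
rewrite !(add_lfunE, scale_lfunE) d1 d2 mulrDl mulrDr -!scalerAl -!scalerAr.
by rewrite scalerDr addrACA.
Qed.

Lemma mem_IDer f : f \in IDer <-> exists c, forall a, f a = c * a - a * c.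
Proof.
apply: mem_vspan; split.
  by exists 0 => a; rewrite lfunE /= mul0r mulr0 subrr.
move=> c f1 f2 [c1 d1] [c2 d2]; exists (c *: c1 + c2) => a.
rewrite add_lfunE scale_lfunE d1 d2 mulrDl mulrDr -scalerAl -scalerAr.
by rewrite scalerBr opprD addrACA.
Qed.

Lemma IDer_sub_Der : (IDer <= Der)%VS.
Proof.
apply/subvP=> f /mem_IDer[c fE]; apply/mem_Der => a b.
by rewrite !fE mulrBl mulrBr !mulrA addrA subrK.
Qed.

Definition centre := subvs_of 'Z({:A})%AS.

Lemma centreP (z : centre) (a : A) : vsval z * a = a * vsval z.
Proof.
have : vsval z \in ('Z({:A}))%VS by exact: subvsP.
by rewrite memv_cap => /andP[_ /centvP zC]; rewrite zC ?memvf.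
Qed.

Fact der_act_subproof (z : centre) (f : subvs_of Der) :
  (amull (vsval z) \o vsval f)%VF \in Der.
Proof.
apply/mem_Der => a b; have /mem_Der df := subvsP f.
by rewrite !(comp_lfunE, lfunE) /= df mulrDr !mulrA (centreP z a).
Qed.

(* (z . f)(a) = z f(a) *)
Definition der_act (z : centre) (f : subvs_of Der) : subvs_of Der :=
  Subvs (der_act_subproof z f).

Definition HH1_act (z : centre) (x : HH1) : HH1 :=
  quotv_pi _ (der_act z (repr x)).

Lemma HH1_act_pi z f : HH1_act z (quotv_pi _ f) = quotv_pi _ (der_act z f).
Proof.
have : quotv_pi _ (repr (quotv_pi _ f : HH1)) = quotv_pi _ f :> HH1.
  exact: quotv_piK.
move=> /quotv_piE; rewrite -memv_preim lfunE => /mem_IDer[c cE].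
apply/quotv_piE; rewrite -memv_preim lfunE; apply/mem_IDer.
exists (vsval z * c) => a; have := cE a.
rewrite /= !(add_lfunE, opp_lfunE, comp_lfunE, lfunE) /= -mulrBr => ->.
by rewrite mulrBr !mulrA (centreP z a).
Qed.

Fact HH1_act_linearl x : linear (HH1_act^~ x).
Proof.
move=> c a b; elim/quotv_ind: x => f; rewrite !HH1_act_pi -linearP.
congr quotv_pi; apply/val_inj/lfunP => y.
by rewrite /= !(add_lfunE, scale_lfunE, comp_lfunE, lfunE) /= mulrDl scalerAl.
Qed.
Fact HH1_act_linearr z : linear (HH1_act z).
Proof.
move=> c; elim/quotv_ind=> f; elim/quotv_ind=> g.
rewrite -linearP !HH1_act_pi -linearP.
congr quotv_pi; apply/val_inj/lfunP => y.
by rewrite /= !(add_lfunE, scale_lfunE, comp_lfunE, lfunE) /= mulrDr scalerAr.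
Qed.
Fact HH1_act1 x : HH1_act 1 x = x.
Proof.
elim/quotv_ind: x => f; rewrite HH1_act_pi.
congr quotv_pi; apply/val_inj/lfunP => y.
have e1 : algid 'Z({:A}) = 1.
  by rewrite algid_center; apply/eqP; rewrite algid_eq1 memvf.
by rewrite /= comp_lfunE lfunE /= e1 mul1r.
Qed.
Fact HH1_actM a b x : HH1_act (a * b) x = HH1_act a (HH1_act b x).
Proof.
elim/quotv_ind: x => f; rewrite !HH1_act_pi.
congr quotv_pi; apply/val_inj/lfunP => y.
by rewrite /= !(comp_lfunE, lfunE) /= mulrA.
Qed.

Definition HH1_amod : amod centre :=
  AMod HH1_act_linearl HH1_act_linearr HH1_act1 HH1_actM.

End Algebra.

(* Main.v *)
Require Import Defs.
From mathcomp Require Import all_boot all_algebra all_field.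
From HB Require Import structures.
From mathcomp Require Import boolp.

(** Both inequalities pass through the dual X of J / (J^2 + [A, J]), where J is
    the radical of A; elements of X are called trace forms.

    Lower bound for the socle of HH^1 (dim_trace_forms_le_socle). Let lam be a
    symmetrizing form of A. A trace form mu determines, by
    lam (b * g a) = mu (b * a), a homomorphism of bimodules g from J to the
    socle of A, and since A / J is separable g extends to a derivation f of A
    with values in the socle (socle_der_of_trace_form). From f one recovers mu
    as the restriction of lam \o f to J; as lam vanishes on commutators, this
    is zero when f is inner, so distinct trace forms give distinct classes in
    HH^1. Derivations into the socle of A are killed by the radical of the
    centre, and their classes lie in the socle of HH^1 (HH1_class_socle).

    Upper bound for self-extensions (sum_dim_Ext1_le). Let S be simple. In an
    extension of S by S, an element a of J induces an endomorphism D a of S, and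
    D is a homomorphism of bimodules from J to End S; so the trace of D is a
    trace form. If it is zero then D is zero by nondegeneracy of the trace, as A
    maps onto End S; then the extension is a module over the semisimple algebra
    A / J and splits (ext_mx0_coboundary). The same argument for all simple
    modules at once, A being onto the product of their endomorphism algebras,
    shows that the sum of the Ext^1 (S, S) embeds in X.

    If A is local and split then A = k + J, so [A, J] lies in J^2 and X is
    dual to J / J^2 (dim_Jrad_quotient_le).

    The separability of A / J is used twice, to extend a bimodule map to a
    derivation and to split an extension. Both times it takes the form of an
    average over lifts to A of the matrix units of A / J, applied to a bilinear
    map that vanishes on J (separability). *)

Set Implicit Arguments.
Unset Strict Implicit.
Unset Printing Implicit Defensive.

Import GRing.Theory.
Local Open Scope ring_scope.

(** * Dimension counts and linear functions *)

Section LinearAlgebra.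
Variable k : fieldType.

Lemma limg_dim_le (U V W : vectType k) (f : 'Hom(U, V)) (g : 'Hom(U, W))
    (X : {vspace U}) :
  (X :&: lker f <= lker g)%VS -> (\dim (g @: X) <= \dim (f @: X))%N.
Proof.
move=> sfg; rewrite -(leq_add2l (\dim (X :&: lker g))) limg_ker_dim.
rewrite -[X in (X <= _)%N](limg_ker_dim f X) leq_add2r dimvS //.
by rewrite subv_cap capvSl.
Qed.

Lemma subquot_dim_le (V W : vectType k) (f : 'Hom(V, W)) (Z B : {vspace V}) :
  (B <= Z)%VS -> (Z :&: lker f <= B)%VS ->
  (\dim {:subquot Z B} <= \dim (f @: Z))%N.
Proof.
move=> sBZ sfB; rewrite dim_subquot // leq_subLR -(limg_ker_dim f Z).
by rewrite leq_add2r dimvS.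
Qed.

Lemma sum_dim_independent (V : vectType k) (I : finType)
    (U : I -> {vspace V}) (X : {vspace V}) :
  (forall i, (U i <= X)%VS) ->
  (forall u, (forall i, u i \in U i) -> \sum_i u i = 0 -> forall i, u i = 0) ->
  (\sum_i \dim (U i) <= \dim X)%N.
Proof.
move=> sUX indep; have : directv (\sum_i U i).
  apply/directv_sum_independent => u uU u0 i _.
  by apply: indep u0 i => i; apply: uU.
by rewrite directvE /= => /eqP <-; apply/dimvS/subv_sumP.
Qed.

Lemma quotv_pi_eq0 (V : vectType k) (U : {vspace V}) v :
  quotv_pi U v = 0 <-> v \in U.
Proof.
by rewrite -[X in _ = X](linear0 (quotv_pi U)) quotv_piE subr0.
Qed.

(** Defined on the whole of V, by first projecting to U, so that classes of
    vectors of V can be taken linearly without carrying membership proofs;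
    only its values on U matter. *)
Definition to_subquot (V : vectType k) (U W : {vspace V}) (v : V) :
  subquot U W := quotv_pi _ (vsproj U v).

Fact to_subquot_is_linear (V : vectType k) (U W : {vspace V}) :
  linear (@to_subquot V U W).
Proof. by move=> a u v; rewrite /to_subquot !linearP. Qed.
HB.instance Definition _ (V : vectType k) (U W : {vspace V}) :=
  GRing.isSemilinear.Build k V (subquot U W) _
  (@to_subquot V U W)
  (GRing.semilinear_linear (@to_subquot_is_linear V U W)).

Lemma to_subquot_eq0 (V : vectType k) (U W : {vspace V}) v : v \in U ->
  to_subquot U W v = 0 <-> v \in W.
Proof.
by move=> Uv; rewrite quotv_pi_eq0 -memv_preim lfunE /= vsprojK.
Qed.

Lemma linear_lincomb (U V : lmodType k) (f : U -> V) (I : finType)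
    (c : I -> k) (F : I -> U) :
  linear f -> f (\sum_i c i *: F i) = \sum_i c i *: f (F i).
Proof.
move=> lf; pose g : {linear U -> V} :=
  HB.pack f (GRing.isSemilinear.Build k U V _ f (GRing.semilinear_linear lf)).
by rewrite -[f]/(g : U -> V) linear_sum; apply: eq_bigr => i _; rewrite linearZ.
Qed.

Lemma linear_diff (U V : lmodType k) (f : U -> V) u v :
  linear f -> f (u - v) = f u - f v.
Proof.
by move=> lf; rewrite addrC -scaleN1r lf scaleN1r addrC.
Qed.

Lemma linear_scale (U V : lmodType k) (f : U -> V) c u :
  linear f -> f (c *: u) = c *: f u.
Proof.
move=> lf; have f0 : f 0 = 0 by rewrite -(subrr 0) linear_diff // subrr.
by rewrite -[c *: u]addr0 lf f0 addr0.
Qed.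

Lemma mx_mulv_inj n (B C : 'M[k]_n) :
  (forall u : 'cV_n, B *m u = C *m u) -> B = C.
Proof.
move=> e; apply/matrixP => i j.
by have /colP/(_ i) := e (delta_mx j 0); rewrite -!colE !mxE.
Qed.

End LinearAlgebra.

(** * The semisimple quotient of a split algebra *)

(** A split algebra is used through the irreducible matrix representations
    that its semisimple quotient provides: they are jointly onto a product of
    matrix algebras and their common kernel is the radical. In particular this
    presents the radical as a two-sided ideal. *)
Record wedderburn (k : fieldType) (A : falgType k) := Wedderburn {
  nblocks : nat;
  bsize : 'I_nblocks -> nat;
  rep : forall l, {linear A -> 'M[k]_((bsize l).+1)};
  rep1 : forall l, rep l 1 = 1;
  repM : forall l a b, rep l (a * b) = rep l a * rep l b;
  rep_lift : forall B : (forall l, 'M[k]_((bsize l).+1)),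
    exists a, forall l, rep l a = B l;
  rep_ker : forall a, a \in Jrad A <-> forall l, rep l a = 0
}.
Arguments nblocks {k A} W : rename.
Arguments bsize {k A} W l : rename.
Arguments rep {k A} W l : rename.
Arguments rep_ker {k A} W a : rename.

Section Wedderburn.
Variables (k : fieldType) (A : falgType k).
Local Notation J := (Jrad A).

Lemma splitA_wedderburn : splitA A -> inhabited (wedderburn A).
Proof.
move=> [r [n [psi [[psi' psiK psiK'] psiL psi1 psiM]]]].
pose th l (a : A) : 'M[k]_((n l).+1) := psi (quotv_pi J a) l.
have thL l : linear (th l) by move=> c a b; rewrite /th linearP psiL.
pose th' l : {linear A -> 'M[k]_((n l).+1)} :=
  HB.pack (th l) (GRing.isSemilinear.Build k A _ _ (th l)
    (GRing.semilinear_linear (thL l))).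
constructor; apply: (@Wedderburn k A r n th') => [l|l a b|B|a].
- exact: psi1.
- exact: psiM.
- pose b : {dffun forall i : 'I_r, 'M[k]_((n i).+1)} := [ffun l => B l].
  exists (repr (psi' b)) => l.
  by rewrite /= /th quotv_piK psiK' ffunE.
- rewrite -quotv_pi_eq0; split=> [a0 l | a0].
    rewrite /= /th a0; have := psiL 1 0 0 l.
    by rewrite !scale1r addr0 => /eqP; rewrite -subr_eq subrr => /eqP.
  apply: (can_inj psiK); apply/ffunP => l.
  by have := a0 l; have := linear0 (th' l); rewrite /= /th linear0 => -> ->.
Qed.

Variable W : wedderburn A.
Implicit Types (l : 'I_(nblocks W)).

Lemma rep_eq_Jrad a b : (forall l, rep W l a = rep W l b) -> a - b \in J.
Proof. by move=> e; apply/(rep_ker W) => l; rewrite linearB /= e subrr. Qed.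

Lemma Jrad_mulr a b : a \in J -> a * b \in J.
Proof.
move=> /(rep_ker W) a0; apply/(rep_ker W) => l.
by rewrite repM a0 mul0r.
Qed.

Lemma Jrad_mull a b : b \in J -> a * b \in J.
Proof.
move=> /(rep_ker W) b0; apply/(rep_ker W) => l.
by rewrite repM b0 mulr0.
Qed.

(** The indices are compared as natural numbers since p and q live in block l
    while the entries to be filled live in block l'; this avoids transporting
    along l' = l. *)
Definition blockwise_unit l (p q : 'I_(bsize W l).+1) l' :
  'M[k]_((bsize W l').+1) :=
  \matrix_(i, j) ([&& l' == l, i == p :> nat & j == q :> nat])%:R.

(** A lift to A of the matrix unit E_pq of block l. Such lifts multiply like
    matrix units only modulo the radical, which is enough wherever the radical
    acts by zero. *)
Definition munit l (p q : 'I_(bsize W l).+1) : A :=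
  projT1 (cid (rep_lift (blockwise_unit p q))).

Lemma rep_munit l (p q : 'I_(bsize W l).+1) :
  rep W l (munit p q) = delta_mx p q.
Proof.
rewrite /munit; case: cid => a /= ->.
by apply/matrixP=> i j; rewrite !mxE eqxx.
Qed.

Lemma rep_munit_neq l l' (p q : 'I_(bsize W l).+1) : l' != l ->
  rep W l' (munit p q) = 0.
Proof.
move=> ne; rewrite /munit; case: cid => a /= ->.
by apply/matrixP=> i j; rewrite !mxE (negPf ne).
Qed.

Lemma mul_munit a l (p q : 'I_(bsize W l).+1) :
  a * munit p q - \sum_s rep W l a s p *: munit s q \in J.
Proof.
apply: rep_eq_Jrad => l'; rewrite repM linear_sum /=.
case: (eqVneq l' l) => [->|ne]; last first.
  rewrite rep_munit_neq // mulr0 big1 // => s _.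
  by rewrite linearZ /= rep_munit_neq // scaler0.
rewrite rep_munit.
apply/matrixP => i j; rewrite summxE !mxE (bigD1 p) //= mxE eqxx /=.
rewrite big1 ?addr0; last first.
  by move=> s sp; rewrite mxE (negPf sp) mulr0.
rewrite (bigD1 i) //= big1 ?addr0; last first.
  by move=> s si; rewrite linearZ /= rep_munit !mxE eq_sym (negPf si) mulr0.
by rewrite linearZ /= rep_munit !mxE eqxx.
Qed.

Lemma munit_mul a l (p q : 'I_(bsize W l).+1) :
  munit p q * a - \sum_s rep W l a q s *: munit p s \in J.
Proof.
apply: rep_eq_Jrad => l'; rewrite repM linear_sum /=.
case: (eqVneq l' l) => [->|ne]; last first.
  rewrite rep_munit_neq // mul0r big1 // => s _.
  by rewrite linearZ /= rep_munit_neq // scaler0.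
rewrite rep_munit.
apply/matrixP => i j; rewrite summxE !mxE (bigD1 q) //= mxE eqxx andbT.
rewrite big1 ?addr0; last first.
  by move=> s sp; rewrite mxE (negPf sp) andbF mul0r.
rewrite (bigD1 j) //= big1 ?addr0; last first.
  move=> s si; rewrite linearZ /= rep_munit !mxE [j == s]eq_sym (negPf si).
  by rewrite andbF mulr0.
by rewrite linearZ /= rep_munit !mxE eqxx andbT mulrC.
Qed.

(** A lift of the central idempotent of the semisimple quotient that cuts out
    block l. *)
Definition block l : A := \sum_(p < (bsize W l).+1) munit p p.

Lemma rep_block l : rep W l (@block l) = 1.
Proof.
rewrite linear_sum /=; under eq_bigr do rewrite rep_munit.
exact: (esym (mx1_sum_delta _ _)).
Qed.

Lemma rep_block_neq l l' : l' != l -> rep W l' (@block l) = 0.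
Proof.
by move=> ne; rewrite linear_sum big1 // => p _; apply: rep_munit_neq.
Qed.

Lemma sum_block : \sum_l @block l - 1 \in J.
Proof.
apply: rep_eq_Jrad => l; rewrite linear_sum rep1 (bigD1 l) //= rep_block.
by rewrite big1 ?addr0 // => l' ne; rewrite rep_block_neq // eq_sym.
Qed.

(** The element sum_(l, p) E_p0 (x) E_0p is a separability idempotent of the
    semisimple quotient: multiplying its left leg by a on the left agrees with
    multiplying its right leg by a on the right, both being
    sum_(s, p) a_sp E_s0 (x) E_0p on each block. Evaluating it in a bilinear
    map that kills the radical on both sides makes sense of this in A. This
    averaging is what replaces a choice of semisimple complement to J(A). *)
Lemma separability (V : lmodType k) (beta : A -> A -> V) :
  (forall y, linear (beta^~ y)) -> (forall x, linear (beta x)) ->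
  (forall x y, x \in J -> beta x y = 0) ->
  (forall x y, y \in J -> beta x y = 0) ->
  forall a,
  \sum_l \sum_(p < (bsize W l).+1) beta (a * munit p 0) (munit 0 p) =
  \sum_l \sum_(p < (bsize W l).+1) beta (munit p 0) (munit 0 p * a).
Proof.
move=> betal betar Jl Jr a; apply: eq_bigr => l _.
have El x x' y : x - x' \in J -> beta x y = beta x' y.
  move=> /(Jl _ y); rewrite (linear_diff x x' (betal y)) => /eqP.
  by rewrite subr_eq0 => /eqP.
have Er x y y' : y - y' \in J -> beta x y = beta x y'.
  move=> /(Jr x); rewrite (linear_diff y y' (betar x)) => /eqP.
  by rewrite subr_eq0 => /eqP.
under eq_bigr => p _ do
  rewrite (El _ _ _ (mul_munit a p 0)) (linear_lincomb _ _ (betal _)).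
rewrite exchange_big /=; apply: eq_bigr => s _.
by rewrite (Er _ _ _ (munit_mul a 0 s)) (linear_lincomb _ _ (betar _)).
Qed.

Lemma separability1 :
  \sum_l \sum_(p < (bsize W l).+1) munit p 0 * munit 0 p - 1 \in J.
Proof.
apply: rep_eq_Jrad => l; rewrite linear_sum rep1 (bigD1 l) //=.
rewrite [X in _ + X]big1 ?addr0.
  rewrite linear_sum -[RHS]/(1%:M) mx1_sum_delta /=; apply: eq_bigr => p _.
  by rewrite repM !rep_munit -[LHS]/(_ *m _) mul_delta_mx.
move=> l' ne; rewrite linear_sum big1 //= => p _.
by rewrite repM rep_munit_neq ?mul0r // eq_sym.
Qed.

End Wedderburn.
Arguments block {k A} W l.

(** * Derivations into the socle of a symmetric algebra *)

Section SymmetrizingForm.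
Variables (k : fieldType) (A : falgType k).
Local Notation J := (Jrad A).

(** The image of 1 under a bimodule isomorphism from A to its dual is such a
    form; conversely it determines the isomorphism. *)
Definition symmetrizing (lam : 'Hom(A, k^o)) : Prop :=
  [/\ forall a b, lam (a * b) = lam (b * a),
      forall a, (forall b, lam (b * a) = 0) -> a = 0 &
      forall mu : 'Hom(A, k^o), exists a, forall b, mu b = lam (b * a)].

Lemma symmetricA_symmetrizing : symmetricA A -> exists lam, symmetrizing lam.
Proof.
move=> [phi [[phi' phiK phiK'] phiM]]; exists (phi 1).
have phiE a b : phi a b = phi 1 (b * a).
  have := phiM a 1 1; rewrite !mulr1 => ->.
  by rewrite /dual_act !comp_lfunE !lfunE /= mul1r.
have phiE' a b : phi a b = phi 1 (a * b).
  have := phiM 1 1 a; rewrite !mul1r => ->.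
  by rewrite /dual_act !comp_lfunE !lfunE /= mulr1.
split=> [a b|a a0|mu]; first by rewrite -phiE' phiE.
  apply: (can_inj phiK); rewrite linear0; apply/lfunP => b.
  by rewrite phiE a0 lfunE.
by exists (phi' mu) => b; rewrite -phiE phiK'.
Qed.

(** The dual of J / (J^2 + [A, J]). The projection vsproj J only serves to view
    the products, which lie in J, as elements of the type of vectors of J. *)
Definition trace_forms : {vspace 'Hom(subvs_of J, k^o)} :=
  vspan (fun mu : 'Hom(subvs_of J, k^o) =>
    (forall a b, a \in J -> b \in J -> mu (vsproj J (a * b)) = 0) /\
    (forall a b, b \in J -> mu (vsproj J (a * b)) = mu (vsproj J (b * a)))).

Lemma mem_trace_forms mu : mu \in trace_forms <->
    (forall a b, a \in J -> b \in J -> mu (vsproj J (a * b)) = 0) /\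
    (forall a b, b \in J -> mu (vsproj J (a * b)) = mu (vsproj J (b * a))).
Proof.
apply: mem_vspan; split; first by split=> [a b _ _|a b _]; rewrite !lfunE.
move=> c u v [u0 uC] [v0 vC]; split=> [a b aJ bJ|a b bJ].
  by rewrite !lfunE /= lfunE /= u0 // v0 // scaler0 addr0.
by rewrite !lfunE /= !lfunE /= uC // vC.
Qed.

(** For symmetric A, the derivations with values in the socle of A: the
    elements annihilated by the radical on both sides. *)
Definition socle_der : {vspace 'End(A)} :=
  vspan (fun f : 'End(A) => is_der f /\
    forall a b, b \in J -> b * f a = 0 /\ f a * b = 0).

Lemma mem_socle_der f : f \in socle_der <-> is_der f /\
    forall a b, b \in J -> b * f a = 0 /\ f a * b = 0.
Proof.
apply: mem_vspan; split.
  split; first by apply/mem_Der; apply: mem0v.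
  by move=> a b _; rewrite lfunE /= mulr0 mul0r.
move=> c f1 f2 [/mem_Der d1 s1] [/mem_Der d2 s2]; split.
  by apply/mem_Der; rewrite memvD ?memvZ.
move=> a b bJ; have [l1 r1] := s1 a b bJ; have [l2 r2] := s2 a b bJ.
rewrite !lfunE /= lfunE /= mulrDr mulrDl -scalerAl -scalerAr.
by rewrite l1 r1 l2 r2 scaler0 addr0.
Qed.

Definition HH1_class : 'Hom('End(A), HH1 A) :=
  linfun (to_subquot (Der A) (IDer A)).

Lemma HH1_class_eq0 f : f \in Der A -> HH1_class f = 0 <-> f \in IDer A.
Proof. by move=> df; rewrite lfunE; apply: to_subquot_eq0. Qed.

(** If every central element acts on f by a scalar, then the line spanned by
    the class of f is a submodule, and it is simple because it is a line. *)
Lemma HH1_class_eigen_socle f : f \in Der A ->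
  (forall z : centre A, exists c, forall a, vsval z * f a = c *: f a) ->
  HH1_class f \in socle (HH1_amod A).
Proof.
move=> df eig; have [->|nz] := eqVneq (HH1_class f) 0; first exact: mem0v.
apply: vspan_sub; exists <[HH1_class f : HH1_amod A]>%VS; last exact: memv_line.
have actf z : exists c, HH1_act z (HH1_class f) = c *: HH1_class f.
  have [c cE] := eig z; exists c.
  rewrite lfunE /= /to_subquot HH1_act_pi -linearZ /=; congr quotv_pi.
  apply/val_inj/lfunP => a.
  by rewrite /= !(comp_lfunE, lfunE) /= vsprojK.
split.
- move=> z _ /vlineP[d ->]; have [c cE] := actf z.
  rewrite [act _ _](linear_scale _ _ (HH1_act_linearr z)) cE.
  by rewrite !rpredZ // memv_line.
- by rewrite -dimv_eq0 dim_vline nz.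
- move=> U _ sUf.
  have [/eqP U0|U0] := boolP (U == 0%VS); [by left | right].
  by apply/eqP; rewrite eqEdim sUf dim_vline nz lt0n dimv_eq0.
Qed.

Variable W : wedderburn A.

(** Only the matrix units are needed to see that a central element acts as a
    scalar: comparing z E_p0 with E_p0 z entrywise gives z_ip = z_00 if i = p
    and 0 otherwise. *)
Lemma rep_centre l (z : centre A) :
  rep W l (vsval z) = (rep W l (vsval z) 0 0)%:M.
Proof.
apply/matrixP => i p; have /(congr1 (rep W l)) := centreP z (munit p 0).
rewrite !repM rep_munit => /matrixP/(_ i 0).
rewrite !mxE (bigD1 p) //= big1 ?addr0; last first.
  by move=> s sp; rewrite mxE (negPf sp) mulr0.
rewrite mxE !eqxx mulr1 => ->; rewrite (bigD1 0) //= big1 ?addr0; last first.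
  by move=> s sp; rewrite mxE (negPf sp) andbF mul0r.
by rewrite mxE eqxx andbT mulr_natl.
Qed.

(** A derivation f into the socle is the sum of its components block l * f.
    Each is again a derivation, as block l is central modulo the radical, and
    the centre acts on it through the scalar by which it acts on block l. *)
Lemma HH1_class_socle : (HH1_class @: socle_der <= socle (HH1_amod A))%VS.
Proof.
apply/subvP => _ /memv_imgP[f /mem_socle_der[df sf] ->].
pose g l := (amull (block W l) \o f)%VF.
have gE l a : g l a = block W l * f a by rewrite comp_lfunE lfunE.
have killl a b c : a - b \in J -> a * f c = b * f c.
  by move=> /(sf c)[+ _]; rewrite mulrBl => /eqP; rewrite subr_eq0 => /eqP.
have -> : f = \sum_l g l.
  apply/lfunP => a; rewrite sum_lfunE; under eq_bigr do rewrite gE.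
  by rewrite -mulr_suml (killl _ _ _ (sum_block W)) mul1r.
rewrite linear_sum; apply: memv_suml => l _; apply: HH1_class_eigen_socle.
  apply/mem_Der => a b; rewrite !gE df mulrDr !mulrA; congr (_ + _).
  apply: killl; apply: rep_eq_Jrad => l'; rewrite !repM.
  have [->|ne] := eqVneq l' l; first by rewrite rep_block mulr1 mul1r.
  by rewrite rep_block_neq // mulr0 mul0r.
move=> z; exists (rep W l (vsval z) 0 0) => a.
rewrite gE mulrA scalerAl; apply: killl; apply: rep_eq_Jrad => l'.
rewrite linearZ /= repM; have [->|ne] := eqVneq l' l.
  by rewrite rep_block mulr1 {1}rep_centre -scalemx1.
by rewrite rep_block_neq // mulr0 scaler0.
Qed.

Variable lam : 'Hom(A, k^o).
Hypothesis lamP : symmetrizing lam.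

Let lamC a b : lam (a * b) = lam (b * a). Proof. by case: lamP. Qed.
Let lam_nondeg a : (forall b, lam (b * a) = 0) -> a = 0.
Proof. by case: lamP => _ + _; apply. Qed.

(** By nondegeneracy, mu and lam determine G a for a in J through
    lam (b * G a) = mu (b * a). That mu vanishes on [A, J] makes G commute with
    multiplication on both sides; that it vanishes on J^2 puts the values of G
    in the socle. Outside J, G is an arbitrary linear extension. *)
Lemma trace_form_bimodule_map mu : mu \in trace_forms ->
  exists G : 'End(A),
    [/\ forall a, a \in J -> lam (G a) = mu (vsproj J a),
        forall a b, b \in J -> b * G a = 0 /\ G a * b = 0 &
        forall a b, a \in J -> G (a * b) = G a * b /\ G (b * a) = b * G a].
Proof.
move=> /mem_trace_forms[mu0 muC].
have lam_inj a b : (forall c, lam (c * a) = lam (c * b)) -> a = b.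
  move=> e; apply/eqP; rewrite -subr_eq0; apply/eqP/lam_nondeg => c.
  by rewrite mulrBr linearB /= e subrr.
have exG a : exists s, forall b, lam (b * s) = mu (vsproj J (b * projv J a)).
  pose form := (mu \o linfun (vsproj J) \o amulr (projv J a))%VF.
  have [_ _ /(_ form)[s sE]] := lamP.
  by exists s => b; rewrite -sE !comp_lfunE !lfunE.
pose G0 a := projT1 (cid (exG a)).
have G0E a b : lam (b * G0 a) = mu (vsproj J (b * projv J a)).
  by rewrite /G0; case: cid => s /= ->.
have G0L : linear G0.
  move=> c a b; apply: lam_inj => d.
  rewrite mulrDr -scalerAr linearD linearZ /= !G0E.
  by rewrite linearP mulrDr -scalerAr !linearP.
pose G1 : {linear A -> A} := HB.pack G0
  (GRing.isSemilinear.Build k A A _ G0 (GRing.semilinear_linear G0L)).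
exists (linfun G1).
have GE a b : lam (b * linfun G1 a) = mu (vsproj J (b * projv J a)).
  by rewrite lfunE G0E.
move: (linfun G1) GE => G GE {G0 G0E G0L G1 exG}.
have GJ a b : a \in J -> lam (b * G a) = mu (vsproj J (b * a)).
  by move=> aJ; rewrite GE projv_id.
have pJ a : projv J a \in J by apply: memv_proj.
split=> [a aJ|a b bJ|a b aJ].
- by rewrite -[G a]mul1r GJ // mul1r.
- split; apply: lam_nondeg => c.
    by rewrite mulrA GE mu0 // (Jrad_mull W).
  by rewrite lamC -mulrA lamC GE mu0 // (Jrad_mulr W).
- split; apply: lam_inj => c.
    rewrite GJ ?(Jrad_mulr W) // mulrA [RHS]lamC mulrA GJ //.
    by rewrite -mulrA [RHS]muC ?(Jrad_mull W) // mulrA.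
  by rewrite GJ ?(Jrad_mull W) // !mulrA GJ.
Qed.

(** The bimodule map G on J extends to a derivation of A, the obstruction being
    a Hochschild 2-cocycle of the separable algebra A / J. Averaging the
    extension gives the closed formula
    f a = sum x (G (y a) - G y a) over the separability idempotent
    sum x (x) y. *)
Lemma socle_der_of_trace_form mu : mu \in trace_forms ->
  exists2 f, f \in socle_der & forall a, a \in J -> lam (f a) = mu (vsproj J a).
Proof.
move=> /trace_form_bimodule_map[G [lamG sG GM]].
pose h (y a : A) := G (y * a) - G y * a.
pose f : 'End(A) := \sum_l \sum_(p < (bsize W l).+1)
  (amull (munit p 0) \o (G \o amull (munit 0 p) - amull (G (munit 0 p))))%VF.
have fE a : f a = \sum_l \sum_(p < (bsize W l).+1)
    munit p 0 * h (munit 0 p) a.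
  rewrite sum_lfunE; apply: eq_bigr => l _; rewrite sum_lfunE.
  apply: eq_bigr => p _; rewrite comp_lfunE [LHS]lfunE /=.
  by rewrite add_lfunE opp_lfunE comp_lfunE /h !lfunE.
have h0 y a : y \in J -> h y a = 0.
  by move=> yJ; rewrite /h; have [-> _] := GM y a yJ; rewrite subrr.
have hJ x y a : x \in J -> x * h y a = 0 /\ h y a * x = 0.
  move=> xJ; rewrite /h mulrBr mulrBl [x * (G y * a)]mulrA -[G y * a * x]mulrA.
  have [-> ->] := sG (y * a) _ xJ; have [-> _] := sG y _ xJ.
  by have [_ ->] := sG y _ (Jrad_mull W a xJ); rewrite mul0r subr0.
have fJ a : a \in J -> f a = G a.
  move=> aJ; rewrite fE.
  have hE y : h y a = y * G a.
    rewrite /h; have [_ ->] := GM a y aJ; have [_ ->] := sG y a aJ.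
    by rewrite subr0.
  under eq_bigr do under eq_bigr do rewrite hE mulrA.
  under eq_bigr do rewrite -mulr_suml.
  rewrite -mulr_suml; apply/eqP; rewrite -subr_eq0 -[X in _ - X]mul1r -mulrBl.
  by have [-> _] := sG a _ (separability1 W).
exists f => [|a aJ]; last by rewrite fJ ?lamG.
apply/mem_socle_der; split=> [a b|a b bJ]; last first.
  split; rewrite fE ?mulr_sumr ?mulr_suml big1 // => l _.
    rewrite mulr_sumr big1 // => p _; rewrite mulrA.
    by have [-> _] := hJ (b * munit p 0) (munit 0 p) a (Jrad_mulr W _ bJ).
  rewrite mulr_suml big1 // => p _; rewrite -mulrA.
  by have [_ ->] := hJ b (munit 0 p) a bJ; rewrite mulr0.
(* Centrality of the separability idempotent is applied to beta in order to
   move a from the left of x to the right of y; then the Leibniz rule is a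
   telescoping sum. *)
pose beta x y := x * h y b.
have hL c : linear (h^~ c).
  move=> d y y'; rewrite /h mulrDl -scalerAl !linearP /= mulrDl -scalerAl.
  by rewrite scalerBr opprD addrACA.
have -> : a * f b = \sum_l \sum_(p < (bsize W l).+1)
    beta (munit p 0) (munit 0 p * a).
  rewrite -(separability W (beta := beta)).
  - rewrite fE mulr_sumr; apply: eq_bigr => l _.
    by rewrite mulr_sumr; apply: eq_bigr => p _; rewrite /beta mulrA.
  - by move=> y c x x'; rewrite /beta mulrDl -scalerAl.
  - by move=> x c y y'; rewrite /beta hL mulrDr -scalerAr.
  - by move=> x y xJ; rewrite /beta; have [-> _] := hJ x y b xJ.
  - by move=> x y yJ; rewrite /beta h0 ?mulr0.
rewrite !fE mulr_suml -big_split; apply: eq_bigr => l _ /=.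
rewrite mulr_suml -big_split; apply: eq_bigr => p _ /=.
rewrite /beta /h -[_ * _ * b]mulrA -mulrDr; congr (_ * _).
by rewrite mulrBl !mulrA [RHS]addrC addrA subrK.
Qed.

Definition trace_restriction (f : 'End(A)) : 'Hom(subvs_of J, k^o) :=
  (lam \o f \o linfun vsval)%VF.

Fact trace_restriction_is_linear : linear trace_restriction.
Proof.
move=> c f g; apply/lfunP => a; rewrite add_lfunE scale_lfunE !comp_lfunE.
by rewrite add_lfunE scale_lfunE linearP.
Qed.
HB.instance Definition _ := GRing.isSemilinear.Build k 'End(A)
  'Hom(subvs_of J, k^o) _ trace_restriction
  (GRing.semilinear_linear trace_restriction_is_linear).

(** Restricting lam \o f to J maps derivations into the socle onto the trace
    forms, and kills inner derivations because lam vanishes on commutators; so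
    the space of trace forms is a quotient of a subspace of the socle of
    HH^1. *)
Lemma dim_trace_forms_le_socle :
  (\dim trace_forms <= \dim (socle (HH1_amod A)))%N.
Proof.
apply: leq_trans (dimvS HH1_class_socle).
apply: (@leq_trans (\dim (linfun trace_restriction @: socle_der))).
  apply/dimvS/subvP => mu /socle_der_of_trace_form[f fS fE].
  suff -> : mu = linfun trace_restriction f by apply: memv_img.
  apply/lfunP => a; rewrite lfunE /= /trace_restriction !comp_lfunE lfunE /=.
  by rewrite fE ?subvsP // vsvalK.
apply: limg_dim_le; apply/subvP => f; rewrite memv_cap !memv_ker.
case/andP=> /mem_socle_der[/mem_Der df _] /eqP/HH1_class_eq0-/(_ df).
move=> /mem_IDer[c cE]; apply/eqP/lfunP => a.
rewrite lfunE /= /trace_restriction !comp_lfunE cE lfunE /=.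
by rewrite zero_lfunE linearB /= lamC subrr.
Qed.

End SymmetrizingForm.

(** * Simple modules over a split algebra *)

Section SimpleModules.
Variables (k : fieldType) (A : falgType k).
Local Notation J := (Jrad A).
Implicit Types M N : amod A.

Fact act_is_linear M a : linear (@act k A M a).
Proof. exact: act_linearr. Qed.
HB.instance Definition _ M a := GRing.isSemilinear.Build k M M _
  (@act k A M a) (GRing.semilinear_linear (@act_is_linear M a)).

Definition act_on M (x : M) (a : A) : M := act a x.

Fact act_on_is_linear M (x : M) : linear (act_on x).
Proof. exact: act_linearl. Qed.
HB.instance Definition _ M (x : M) := GRing.isSemilinear.Build k A M _
  (act_on x) (GRing.semilinear_linear (act_on_is_linear x)).

Lemma simpleA_full M (U : {vspace M}) x : simpleA M -> submod U ->
  x \in U -> x != 0 -> U = fullv.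
Proof.
move=> [_ _ sM] sU xU x0; case: (sM U sU (subvf U)) => // U0.
by move: xU; rewrite U0 memv0 (negPf x0).
Qed.

Lemma orbit_homA M (x : M) :
  is_homA (linfun (act_on x) : 'Hom(regular_amod A, M)).
Proof. by move=> a b; rewrite !lfunE /= /act_on actM. Qed.

(** The annihilator of a nonzero vector of a simple module is a maximal left
    ideal. *)
Lemma Jrad_simpleA M a (x : M) : simpleA M -> a \in J -> act a x = 0.
Proof.
move=> sM; have [->|x0] := eqVneq x 0; first by rewrite act0r.
pose f : 'Hom(regular_amod A, M) := linfun (act_on x).
have fE b : f b = act b x by rewrite lfunE.
move=> /mem_Jrad/(_ (lker f)) aJ.
suff /aJ : max_left_ideal (lker f : {vspace A}).
  by rewrite memv_ker => /eqP <-; rewrite fE.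
split; first exact: ker_submod (orbit_homA x).
  apply: contra_neq x0 => kf; apply/eqP.
  by rewrite -(act1 x) -fE -memv_ker kf memvf.
move=> U sU kU; have [[b bU bx]|noU] := pselect (exists2 b, b \in U & f b != 0).
  right; apply/eqP; rewrite eqEsubv subvf; apply/subvP => c _.
  (* The orbit map sends U onto a nonzero submodule, hence onto M; so every c
     agrees with an element of U up to the kernel. *)
  have sfU : submod (f @: U)%VS.
    move=> d _ /memv_imgP[y yU ->]; rewrite -(orbit_homA x).
    by apply/memv_img/sU.
  have : f c \in (f @: U)%VS.
    by rewrite (simpleA_full sM sfU (memv_img f bU) bx) memvf.
  case/memv_imgP=> y yU /eqP; rewrite -subr_eq0 -linearB /= -memv_ker => cy.
  by rewrite -(subrK y c) rpredD // (subvP kU).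
left; apply/eqP; rewrite eqEsubv kU andbT; apply/subvP => b bU.
by rewrite memv_ker; apply: contra_notT noU => nb; exists b.
Qed.

Variable W : wedderburn A.

(** An isomorphism from the column vectors, on which A acts through rep l. *)
Definition column_model M l (phi : 'Hom('cV[k]_((bsize W l).+1), M)) : Prop :=
  [/\ lker phi == 0%VS, limg phi = fullv &
      forall a u, phi (rep W l a *m u) = act a (phi u)].

(** Some matrix unit E_0p moves some vector x to y <> 0, and then the vectors
    E_q0 y correspond to the standard basis. *)
Lemma simpleA_column_model M : simpleA M ->
  exists l phi, @column_model M l phi.
Proof.
move=> sM; have [_ M0 _] := sM.
pose x := vpick (fullv : {vspace M}).
have x0 : x != 0 by rewrite vpick0.
have actJ a b (y : M) : a - b \in J -> act a y = act b y.
  move=> /(Jrad_simpleA y sM); rewrite -/(act_on y _) linearB => /eqP.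
  by rewrite subr_eq0 => /eqP.
(* Otherwise sum E_p0 E_0p, which acts as 1, would kill x. *)
have [l [p y0]] : exists l (p : 'I_(bsize W l).+1), act (munit 0 p) x != 0.
  apply: contrapT => no; case/negP: x0; apply/eqP.
  rewrite -(act1 x) -(actJ _ _ x (separability1 W)) -/(act_on x _).
  rewrite linear_sum big1 // => l _; rewrite linear_sum big1 // => p _.
  rewrite /= /act_on actM; have [->|nz] := eqVneq (act (munit 0 p) x) 0.
    by rewrite act0r.
  by case: no; exists l, p.
set y := act _ x in y0.
(* The vector y comes from E_0p, hence is fixed by E_00. *)
have y00 : act (munit (0 : 'I_(bsize W l).+1) 0) y = y.
  rewrite /y -actM; apply: actJ; apply: (@rep_eq_Jrad _ _ W) => l'.
  rewrite repM; have [->|ne] := eqVneq l' l; last first.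
    by rewrite !rep_munit_neq // mul0r.
  by rewrite !rep_munit -[LHS]/(_ *m _) mul_delta_mx.
pose phi0 (u : 'cV[k]_((bsize W l).+1)) : M :=
  \sum_q u q 0 *: act (munit q 0) y.
have phi0L : linear phi0.
  move=> c u v; rewrite /phi0 scaler_sumr -big_split; apply: eq_bigr => q _ /=.
  by rewrite !mxE scalerDl scalerA.
pose phi1 : {linear 'cV[k]_((bsize W l).+1) -> M} := HB.pack phi0
  (GRing.isSemilinear.Build k _ M _ phi0 (GRing.semilinear_linear phi0L)).
pose phi := linfun phi1; exists l, phi.
have phiE u : phi u = \sum_q u q 0 *: act (munit q 0) y by rewrite lfunE.
have phiM a u : phi (rep W l a *m u) = act a (phi u).
  rewrite !phiE linear_sum; under eq_bigr do rewrite mxE scaler_suml.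
  rewrite exchange_big; apply: eq_bigr => s _ /=.
  rewrite linearZ /= -actM (actJ _ _ y (mul_munit a s 0)) -/(act_on y _).
  rewrite linear_sum scaler_sumr; apply: eq_bigr => q _ /=.
  by rewrite linearZ /= scalerA mulrC.
have phi_delta q : phi (delta_mx q 0) = act (munit q 0) y.
  rewrite phiE (bigD1 q) //= big1 ?addr0 ?mxE ?eqxx ?scale1r // => s sq.
  by rewrite mxE (negPf sq) scale0r.
split=> //.
  apply/eqP/eqP; rewrite -subv0; apply/subvP => u; rewrite memv_ker => /eqP u0.
  rewrite memv0; apply/eqP/colP => q; rewrite mxE.
  have : phi (delta_mx 0 q *m u) = 0 by rewrite -(rep_munit 0 q) phiM u0 act0r.
  have -> : delta_mx 0 q *m u = u q 0 *: delta_mx (0 : 'I_(bsize W l).+1) 0.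
    apply/colP => s; rewrite !mxE (bigD1 q) //= big1 ?addr0; last first.
      by move=> j jq; rewrite mxE (negPf jq) andbF mul0r.
    by rewrite mxE eqxx !andbT mulrC.
  rewrite linearZ /= phi_delta y00 => /eqP.
  by rewrite scaler_eq0 (negPf y0) orbF => /eqP.
have sphi : submod (limg phi).
  by move=> a _ /memv_imgP[u _ ->]; rewrite -phiM; apply/memv_img/memvf.
apply: (simpleA_full sM sphi _ y0).
by rewrite -y00 -phi_delta; apply/memv_img/memvf.
Qed.

(** A simple module is determined by its block, so that non-isomorphic simple
    modules belong to distinct blocks. *)
Lemma column_model_isoA M N l phi psi :
  @column_model M l phi -> @column_model N l psi -> isoA M N.
Proof.
move=> [phi0 phif phiM] [psi0 psif psiM].
have phiK x : phi (phi^-1%VF x) = x by apply: limg_lfunVK; rewrite phif memvf.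
have psiK x : psi (psi^-1%VF x) = x by apply: limg_lfunVK; rewrite psif memvf.
exists (psi \o phi^-1)%VF; split.
  move=> a x; rewrite !comp_lfunE -psiM; congr (psi _).
  by apply: (can_inj (lker0_lfunK phi0)); rewrite phiK phiM phiK.
exists (phi \o psi^-1)%VF => x; rewrite !comp_lfunE /=.
  by rewrite (lker0_lfunK psi0) phiK.
by rewrite (lker0_lfunK phi0) psiK.
Qed.

End SimpleModules.

(** * Self-extensions of simple modules as trace forms *)

Section SelfExtensions.
Variables (k : fieldType) (A : falgType k) (W : wedderburn A).
Local Notation J := (Jrad A).
(* The free cover of a module, not the union of a set of sets. *)
Local Notation cover := Defs.cover.

Section OneModule.
Variables (M : amod A) (l : 'I_(nblocks W)).
Variable phi : 'Hom('cV[k]_((bsize W l).+1), M).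
Local Notation K := (lker (cover M)).
Local Notation cochain := 'Hom(free_cover (Omega M), M).

(** A cocycle f factors through the cover of Omega M, hence is the same as an
    A-linear map K -> M. This is that map, extended linearly to the free cover
    of M. *)
Definition cochain_ext (f : cochain) : 'Hom(free_cover M, M) :=
  (f \o (cover (Omega M))^-1 \o linfun (vsproj K))%VF.

Definition cover_lift (u : 'cV[k]_((bsize W l).+1)) : free_cover M :=
  ((cover M)^-1)%VF (phi u).

(** In an extension E of M by M, an element a of J maps E into the submodule M
    and kills that submodule, thus induces an endomorphism of M; this is its
    matrix. It is computed by lifting a vector of M to the free cover, applying
    a, and evaluating the cocycle. *)
Definition ext_mx (f : cochain) (a : A) : 'M[k]_((bsize W l).+1) :=
  \matrix_(q, p)
    (phi^-1)%VF (cochain_ext f (act a (cover_lift (delta_mx p 0)))) q 0.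

Definition ext_trace_fun (f : cochain) (a : subvs_of J) : k^o :=
  \tr (ext_mx f (vsval a)).

Fact ext_mx_linearr f : linear (ext_mx f).
Proof.
move=> c a b; apply/matrixP => q p; rewrite !mxE.
by rewrite -/(act_on _ _) !linearP /= !mxE.
Qed.

Fact ext_mx_linearl a : linear (ext_mx^~ a).
Proof.
move=> c f g; apply/matrixP => q p; rewrite !mxE /cochain_ext !comp_lfunE.
by rewrite add_lfunE scale_lfunE linearP !mxE.
Qed.

Fact ext_trace_fun_is_linear f : linear (ext_trace_fun f).
Proof.
by move=> c a b; rewrite /ext_trace_fun linearP ext_mx_linearr linearP.
Qed.
HB.instance Definition _ f := GRing.isSemilinear.Build k (subvs_of J) k^o _
  (ext_trace_fun f) (GRing.semilinear_linear (ext_trace_fun_is_linear f)).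

Definition ext_trace (f : cochain) : 'Hom(subvs_of J, k^o) :=
  linfun (ext_trace_fun f).

Fact ext_trace_is_linear : linear ext_trace.
Proof.
move=> c f g; apply/lfunP => a; rewrite add_lfunE scale_lfunE !lfunE /=.
by rewrite /ext_trace_fun ext_mx_linearl linearP.
Qed.
HB.instance Definition _ := GRing.isSemilinear.Build k cochain
  'Hom(subvs_of J, k^o) _ ext_trace
  (GRing.semilinear_linear ext_trace_is_linear).

Hypotheses (sM : simpleA M) (phiP : column_model phi).

Let phiK : cancel phi (phi^-1)%VF.
Proof. by case: phiP => phi0 _ _; apply: lker0_lfunK. Qed.
Let phiVK : cancel (phi^-1)%VF phi.
Proof. by case: phiP => _ phif _ x; apply: limg_lfunVK; rewrite phif memvf. Qed.
Let phiVM a x : (phi^-1)%VF (act a x) = rep W l a *m (phi^-1)%VF x.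
Proof. by apply: (can_inj phiK); case: phiP => _ _ ->; rewrite !phiVK. Qed.
Let coverVK (N : amod A) : cancel ((cover N)^-1)%VF (cover N).
Proof. by move=> x; apply: limg_lfunVK; rewrite limg_cover memvf. Qed.

Lemma Jrad_act_cover a (x : free_cover M) : a \in J -> act a x \in K.
Proof. by move=> aJ; rewrite memv_ker cover_homA Jrad_simpleA. Qed.

Section OneCocycle.
Variable f : cochain.
Hypothesis fZ : f \in Ext1_cocycles M M.

Lemma cochain_ext_res_diff y : cochain_ext f (res_diff M y) = f y.
Proof.
have [_ /lfunP f0] := (mem_Ext1_cocycles f).1 fZ.
have rE : res_diff M y = vsval (cover (Omega M) y) by rewrite comp_lfunE lfunE.
rewrite rE /cochain_ext !comp_lfunE [linfun _ _]lfunE /= vsvalK.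
apply/eqP; rewrite -subr_eq0 -linearB /=.
set z : free_cover (Omega M) := _ - _.
have : z \in lker (cover (Omega M)).
  by rewrite memv_ker linearB subr_eq0; apply/eqP; apply: coverVK.
rewrite -limg_res_diff => /memv_imgP[t _ ->].
by have := f0 t; rewrite comp_lfunE zero_lfunE => ->.
Qed.

Lemma res_diff_lift x : x \in K -> exists y, x = res_diff M y.
Proof. by rewrite -limg_res_diff => /memv_imgP[y _ ->]; exists y. Qed.

Lemma cochain_ext_act a x : x \in K ->
  cochain_ext f (act a x) = act a (cochain_ext f x).
Proof.
have [fM _] := (mem_Ext1_cocycles f).1 fZ.
by move=> /res_diff_lift[y ->]; rewrite -res_diff_homA !cochain_ext_res_diff fM.
Qed.

(** Two lifts of a vector differ by an element of K, whose image in M is killed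
    by a; so the matrix ext_mx f a does not depend on the choice of lifts. *)
Lemma cochain_ext_Jrad a x y : a \in J -> cover M x = cover M y ->
  cochain_ext f (act a x) = cochain_ext f (act a y).
Proof.
move=> aJ exy; apply/eqP; rewrite -subr_eq0 -!linearB /=.
have xyK : x - y \in K by rewrite memv_ker linearB /= exy subrr.
by rewrite cochain_ext_act // Jrad_simpleA.
Qed.

Lemma ext_mx_mulv a u :
  ext_mx f a *m u = (phi^-1)%VF (cochain_ext f (act a (cover_lift u))).
Proof.
have {2}-> : u = \sum_p u p 0 *: delta_mx p 0.
  by rewrite [LHS]matrix_sum_delta; apply: eq_bigr => p _; rewrite big_ord1.
rewrite /cover_lift !linear_sum; apply/colP => q; rewrite summxE !mxE.
by apply: eq_bigr => p _; rewrite !linearZ !mxE mulrC.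
Qed.

Lemma ext_mx_mull b a : a \in J -> ext_mx f (b * a) = rep W l b *m ext_mx f a.
Proof.
move=> aJ; apply: mx_mulv_inj => u; rewrite -mulmxA !ext_mx_mulv actM.
by rewrite cochain_ext_act ?Jrad_act_cover // phiVM.
Qed.

Lemma ext_mx_mulr b a : a \in J -> ext_mx f (a * b) = ext_mx f a *m rep W l b.
Proof.
move=> aJ; apply: mx_mulv_inj => u; rewrite -mulmxA !ext_mx_mulv actM.
congr (_ _); apply: cochain_ext_Jrad => //.
by rewrite cover_homA /cover_lift !coverVK; case: phiP => _ _ ->.
Qed.

Lemma ext_traceE a : a \in J -> ext_trace f (vsproj J a) = \tr (ext_mx f a).
Proof. by move=> aJ; rewrite lfunE /= /ext_trace_fun vsprojK. Qed.

(** On J the map ext_mx f is a homomorphism of bimodules, with A acting on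
    matrices through rep l; composing with the trace gives a form that vanishes
    on commutators. *)
Lemma ext_trace_forms : ext_trace f \in trace_forms A.
Proof.
apply/mem_trace_forms; split=> a b.
  move=> aJ bJ; have a0 := (rep_ker W a).1 aJ.
  by rewrite ext_traceE ?(Jrad_mulr W) // ext_mx_mull // a0 mul0mx linear0.
move=> bJ.
rewrite (ext_traceE (Jrad_mull W a bJ)) (ext_traceE (Jrad_mulr W a bJ)).
by rewrite ext_mx_mull // ext_mx_mulr // mxtrace_mulC.
Qed.

(** The trace form of the matrix algebra is nondegenerate, and rep l reaches
    all matrix units. *)
Lemma ext_mx_nondeg a : a \in J ->
  (forall p q : 'I_(bsize W l).+1, \tr (ext_mx f (munit p q * a)) = 0) ->
  ext_mx f a = 0.
Proof.
move=> aJ tr0; apply/matrixP => q p; rewrite [RHS]mxE -[RHS](tr0 p q).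
rewrite ext_mx_mull // rep_munit; move: (ext_mx f a) => D.
rewrite /mxtrace (bigD1 p) //= big1 ?addr0; last first.
  by move=> s sp; rewrite mxE big1 // => j _; rewrite mxE (negPf sp) mul0r.
rewrite mxE (bigD1 q) //= big1 ?addr0 ?mxE ?eqxx ?mul1r // => s sq.
by rewrite mxE (negPf sq) andbF mul0r.
Qed.

(** If J acts by zero on the extension then the extension is a module over the
    semisimple algebra A / J, hence splits: averaging the linear map
    cochain_ext f over the separability idempotent makes it A-linear without
    changing it on K. *)
Lemma ext_mx0_coboundary : (forall a, a \in J -> ext_mx f a = 0) ->
  f \in Ext1_coboundaries M M.
Proof.
move=> f0.
have gJ a x : a \in J -> cochain_ext f (act a x) = 0.
  move=> aJ; apply: (can_inj phiVK); rewrite linear0.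
  have := ext_mx_mulv a ((phi^-1)%VF (cover M x)); rewrite f0 // mul0mx => ->.
  by congr (_ _); apply: cochain_ext_Jrad; rewrite // /cover_lift phiVK coverVK.
pose g' : 'Hom(free_cover M, M) := \sum_l \sum_(p < (bsize W l).+1)
  (linfun (@act _ _ M (munit p 0)) \o cochain_ext f
     \o linfun (@act _ _ (free_cover M) (munit 0 p)))%VF.
have g'E x : g' x = \sum_l \sum_(p < (bsize W l).+1)
    act (munit p 0) (cochain_ext f (act (munit 0 p) x)).
  rewrite sum_lfunE; apply: eq_bigr => i _; rewrite sum_lfunE.
  by apply: eq_bigr => p _; rewrite !comp_lfunE !lfunE.
apply/mem_Ext1_coboundaries; exists g'.
  move=> a x; pose beta b c := act b (cochain_ext f (act c x)).
  transitivity (\sum_l \sum_(p < (bsize W l).+1)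
      beta (munit p 0) (munit 0 p * a)).
    rewrite g'E; apply: eq_bigr => i _; apply: eq_bigr => p _.
    by rewrite /beta actM.
  rewrite -(separability W (beta := beta)).
  - rewrite g'E linear_sum; apply: eq_bigr => i _.
    by rewrite linear_sum; apply: eq_bigr => p _; rewrite /beta actM.
  - by move=> c d b b'; rewrite /beta act_linearl.
  - by move=> b d c c'; rewrite /beta act_linearl !linearP.
  - by move=> b c bJ; rewrite /beta Jrad_simpleA.
  - by move=> b c cJ; rewrite /beta gJ // linear0.
apply/lfunP => y; rewrite comp_lfunE g'E.
have yK : res_diff M y \in K by rewrite -limg_res_diff; apply/memv_img/memvf.
have sep := Jrad_simpleA (f y) sM (separability1 W).
move: sep; rewrite -/(act_on _ _) linearB /= /act_on act1 => /eqP.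
rewrite subr_eq0 => /eqP <-; rewrite -/(act_on _ _) linear_sum.
apply: eq_bigr => i _; rewrite linear_sum; apply: eq_bigr => p _ /=.
by rewrite /act_on actM cochain_ext_act // cochain_ext_res_diff.
Qed.

End OneCocycle.
End OneModule.

(** For each simple module, the trace form of a self-extension determines its
    class. The spaces obtained from different simple modules are independent:
    multiplying the argument by the lift of a matrix unit of one block kills
    the contributions of all other blocks. *)
Lemma sum_dim_Ext1_le (I : finType) (S : I -> amod A) :
  (forall i, simpleA (S i)) -> (forall i j, isoA (S i) (S j) -> i = j) ->
  (\sum_i \dim {:Ext1 (S i) (S i)} <= \dim (trace_forms A))%N.
Proof.
move=> sS injS.
have model i := cid (simpleA_column_model W (sS i)).
pose l i := projT1 (model i).
pose phi i : 'Hom('cV[k]_((bsize W (l i)).+1), S i) :=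
  projT1 (cid (projT2 (model i))).
have phiP i : @column_model _ _ W _ (l i) (phi i) :=
  projT2 (cid (projT2 (model i))).
(* Forgetting the definitions of l and phi allows l i to be rewritten in the
   type of phi i. *)
clearbody phi l.
have l_inj i j : l i = l j -> i = j.
  move=> lij; apply: injS; move: (phi i) (phiP i); rewrite lij => psi psiP.
  exact: column_model_isoA psiP (phiP j).
pose T i := linfun (ext_trace (phi i)).
pose Z i := Ext1_cocycles (S i) (S i).
apply: (@leq_trans (\sum_i \dim (T i @: Z i))).
  apply: leq_sum => i _; apply: subquot_dim_le.
    exact: Ext1_coboundaries_sub.
  apply/subvP => f; rewrite memv_cap memv_ker lfunE /= => /andP[fZ /eqP f0].
  apply: (ext_mx0_coboundary (sS i) (phiP i)) => // a aJ.
  apply: (ext_mx_nondeg (sS i) (phiP i)) => // p q.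
  by rewrite -ext_traceE ?(Jrad_mull W) // f0 zero_lfunE.
apply: sum_dim_independent => [i|u uT u0 i].
  apply/subvP => _ /memv_imgP[f fZ ->].
  by rewrite lfunE; apply: (ext_trace_forms (sS i) (phiP i)).
have [f fE] : exists f : forall i, 'Hom(free_cover (Omega (S i)), S i),
    forall i, f i \in Z i /\ u i = ext_trace (phi i) (f i).
  have ex j : exists g, g \in Z j /\ u j = ext_trace (phi j) g.
    by have /memv_imgP[g gZ ->] := uT j; exists g; rewrite lfunE.
  by exists (fun j => projT1 (cid (ex j))) => j; case: cid.
have trE j a : a \in J -> u j (vsproj J a) = \tr (ext_mx (phi j) (f j) a).
  by move=> aJ; have [_ ->] := fE j; rewrite ext_traceE.
have tr0 a : a \in J -> \sum_j \tr (ext_mx (phi j) (f j) a) = 0.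
  move=> aJ; move/lfunP: u0 => /(_ (vsproj J a)).
  rewrite sum_lfunE zero_lfunE => e; rewrite -[RHS]e.
    by apply: eq_bigr => j _; rewrite trE.
apply/lfunP => a; rewrite zero_lfunE -[a]vsvalK trE ?subvsP //.
rewrite (ext_mx_nondeg (sS i) (phiP i)) ?linear0 ?subvsP //.
  by case: (fE i).
move=> p q; rewrite -[RHS](tr0 (munit p q * vsval a)); last first.
  by rewrite (Jrad_mull W) ?subvsP.
rewrite (bigD1 i) //= big1 ?addr0 // => j ji.
rewrite (ext_mx_mull (sS j) (phiP j)) ?subvsP //; last by case: (fE j).
rewrite rep_munit_neq ?mul0mx ?linear0 //.
by apply: contra_neq ji => /l_inj.
Qed.

End SelfExtensions.

(** * Local algebras *)

Section LocalAlgebras.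
Variables (k : fieldType) (A : falgType k) (W : wedderburn A).
Local Notation J := (Jrad A).

Lemma localA_max_left_ideal : localA A -> max_left_ideal J.
Proof.
move=> [U [mU uniqU]]; suff -> : J = U by [].
apply/vspaceP => x; apply/idP/idP => [/mem_Jrad/(_ U mU) //|xU].
by apply/mem_Jrad => V /uniqU <-.
Qed.

(** Matrices of block l with zero first column pull back to a proper left ideal
    containing J, hence equal to J when J is maximal. So there is no other
    block, and the block l has size 1, since otherwise the ideal would contain
    the lift of a matrix unit. *)
Lemma localA_scalar a : localA A -> exists c, a - c *: 1 \in J.
Proof.
move=> /localA_max_left_ideal[_ J1 maxJ].
have [l _] : exists l : 'I_(nblocks W), True.
  apply: contrapT => no; case/eqP: J1; apply/eqP; rewrite eqEsubv subvf.
  by apply/subvP => x _; apply/(rep_ker W) => l; case: no; exists l.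
pose f (x : A) : 'cV[k]_((bsize W l).+1) := col 0 (rep W l x).
have fL : linear f by move=> c x y; rewrite /f !linearP.
pose g : {linear A -> _} := HB.pack f
  (GRing.isSemilinear.Build k A _ _ f (GRing.semilinear_linear fL)).
pose U : {vspace A} := lker (linfun g).
have memU x : (x \in U) = (col 0 (rep W l x) == 0).
  by rewrite memv_ker lfunE.
have UJ : U = J.
  have sU : submod (U : {vspace regular_amod A}).
    move=> b x; rewrite !memU /= repM => /eqP x0.
    by rewrite colE -[_ *m _]mulmxA -colE x0 mulmx0.
  case: (maxJ U sU) => // [|U1].
    apply/subvP => x /(rep_ker W)/(_ l) x0.
    by rewrite memU x0 linear0.
  have : 1 \in U by rewrite U1 memvf.
  rewrite memU rep1 => /eqP/colP/(_ 0)/eqP.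
  by rewrite !mxE eqxx oner_eq0.
have l_uniq l' : l' = l.
  apply/eqP/contraT => ne.
  have : munit (0 : 'I_(bsize W l').+1) 0 \in U.
    by rewrite memU rep_munit_neq ?linear0 // eq_sym.
  rewrite UJ => /(rep_ker W)/(_ l'); rewrite rep_munit => /matrixP/(_ 0 0)/eqP.
  by rewrite !mxE !eqxx oner_eq0.
have size1 (p : 'I_(bsize W l).+1) : p = 0.
  apply/eqP/contraT => p0.
  have : munit (0 : 'I_(bsize W l).+1) p \in U.
    rewrite memU rep_munit; apply/eqP/colP => i.
    by rewrite !mxE [0 == p]eq_sym (negPf p0) andbF.
  rewrite UJ => /(rep_ker W)/(_ l); rewrite rep_munit => /matrixP/(_ 0 p)/eqP.
  by rewrite !mxE !eqxx oner_eq0.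
exists (rep W l a 0 0); apply: (rep_eq_Jrad (W := W)) => l'.
rewrite (l_uniq l') linearZ /= rep1; apply/matrixP => i j.
by rewrite (size1 i) (size1 j) !mxE eqxx mulr1.
Qed.

(** Since A = k + J, the commutators [A, J] already lie in J^2, so every form on
    J / J^2 is a trace form. *)
Lemma dim_Jrad_quotient_le : localA A ->
  (\dim {:subquot J (J * J)%VS} <= \dim (trace_forms A))%N.
Proof.
move=> locA; set Q := subquot J (J * J)%VS.
pose pull (nu : 'Hom(Q, k^o)) : 'Hom(subvs_of J, k^o) :=
  (nu \o linfun (quotv_pi _))%VF.
have pullL : linear pull by move=> c u v; rewrite /pull comp_lfunDl comp_lfunZl.
pose T := linfun (HB.pack pull (GRing.isSemilinear.Build k _ _ _ pull
  (GRing.semilinear_linear pullL)) : {linear _ -> _}).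
have TE nu x : T nu x = nu (quotv_pi _ x) by rewrite lfunE comp_lfunE lfunE.
have kT : lker T == 0%VS.
  rewrite -subv0; apply/subvP => nu; rewrite memv_ker => /eqP nu0.
  rewrite memv0; apply/eqP/lfunP; elim/quotv_ind => x.
  by rewrite -TE nu0 !lfunE.
have -> : \dim {:Q} = \dim (T @: fullv)%VS.
  rewrite limg_dim_eq ?(eqP kT) ?capv0 // !dimvf.
  by rewrite /dim /= muln1.
apply: dimvS; apply/subvP => _ /memv_imgP[nu _ ->].
have kill x : x \in (J * J)%VS -> T nu (vsproj J x) = 0.
  move=> xJJ; rewrite TE (_ : quotv_pi _ _ = 0) ?linear0 //.
  apply/quotv_pi_eq0; rewrite -memv_preim lfunE /= vsprojK //.
  apply: subvP xJJ; apply/prodvP => u v uJ _; exact: (Jrad_mulr W).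
apply/mem_trace_forms; split=> [a b aJ bJ|a b bJ]; first exact/kill/memv_mul.
have [c aJ] := localA_scalar a locA.
apply/eqP; rewrite -subr_eq0 -!linearB /=; apply/eqP/kill.
have -> : a * b - b * a = (a - c *: 1) * b - b * (a - c *: 1).
  rewrite mulrBl mulrBr -scalerAl -scalerAr mul1r mulr1 opprB addrA subrK.
  by [].
by rewrite rpredB // memv_mul.
Qed.

End LocalAlgebras.

Theorem theorem1p2 (k : fieldType) (A : falgType k) :
  symmetricA A -> splitA A ->
  (forall (I : finType) (S : I -> amod A), simple_representatives S ->
     (\sum_(i : I) \dim {:Ext1 (S i) (S i)} <= \dim (socle (HH1_amod A)))%N)
  /\
  (localA A ->
     (\dim {:subquot (Jrad A) (Jrad A * Jrad A)%VS}
        <= \dim (socle (HH1_amod A)))%N).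
Proof.
move=> /symmetricA_symmetrizing[lam lamP] /splitA_wedderburn[W].
have le_soc := dim_trace_forms_le_socle W lamP.
split=> [I S [sS injS _]|locA]; apply: leq_trans le_soc.
  exact: sum_dim_Ext1_le.
exact: dim_Jrad_quotient_le.
Qed.
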